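(* Let $\mu$ be a finite deficient topological measure on $X$. (i) There exists a unique p-conic quasi-linear functional $\mathcal{R}$ on $C_0^+(X)$ of finite norm such that $\mu=\mu_{\mathcal{R}}$ and $\|\mathcal{R}\|=\mu(X)$. In fact, $\mathcal{R}=\mathcal{R}_\mu$ (restricted to $C_0^+(X)$). (ii) If $X$ is compact, the unique functional can be taken to be a real-valued r-functional on $C(X)$; that is, there exists a unique real-valued r-functional $\mathcal{R}$ on $C(X)$ such that $\mu=\mu_{\mathcal{R}}$ and $\|\mathcal{R}\|=\mu(X)$, namely $\mathcal{R}=\mathcal{R}_\mu$.
   Context: $X$ is a locally compact Hausdorff connected space; $\mathscr{O}(X),\mathscr{C}(X),\mathscr{K}(X)$ are the families of open, closed, compact subsets of $X$. $C_b(X)$, $C_0(X)$, $C_c(X)$: real continuous functions that are bounded, vanish at infinity, have compact support, respectively (sup norm $\|\cdot\|$); $C_0(X)=C(X)$ if $X$ is compact. $C_0^+(X)=\{f\in C_0(X): f\ge 0\}$. $\operatorname{supp} f=\overline{\{f\ne 0\}}$. A deficient topological measure on $X$ is $\nu:\mathscr{C}(X)\cup\mathscr{O}(X)\to[0,\infty]$ such that: $\nu(C\sqcup K)=\nu(C)+\nu(K)$ for disjoint $C,K\in\mathscr{K}(X)$; $\nu(U)=\sup\{\nu(C): C\subseteq U, C\in\mathscr{K}(X)\}$ for $U\in\mathscr{O}(X)$; $\nu(F)=\inf\{\nu(U): F\subseteq U, U\in\mathscr{O}(X)\}$ for $F\in\mathscr{C}(X)$. It is finite if $\nu(X)<\infty$.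 For $f\in C_0(X)$ let $A^+(f)$ be the set of functions $\phi\circ f$ with $\phi:\overline{f(X)}\to\mathbb{R}$ continuous non-decreasing, where additionally $\phi(0)=0$ is required if $X$ is not compact. Functionals take values in $[-\infty,\infty]$, attain at most one of $\pm\infty$ and are not identically $\infty$ or $-\infty$. A functional $\rho$ on a domain $D\subseteq C_0(X)$ ($D=C_0(X)$ or $C_0^+(X)$) with $|\rho(0)|<\infty$ is p-conic quasi-linear if for functions in $D$: (p1) $fg=0$, $f,g\ge0$ imply $\rho(f+g)=\rho(f)+\rho(g)$; (p2) $0\le g\le f$ implies $\rho(g)\le\rho(f)$; (p3) for each $f\in C_0(X)$, if $g,h\in A^+(f)\cap D$ and $a,b\ge0$ then $\rho(ag+bh)=a\rho(g)+b\rho(h)$. For compact $X$, a functional $\rho$ on $C(X)$ with $|\rho(0)|<\infty$ is an r-functional if: $\rho(af)=a\rho(f)$ for $a>0$; $0\le g\le f$ implies $\rho(g)\le\rho(f)$; if $fg=0$ and either $f,g\ge0$ or $f\ge0,g\le0$, then $\rho(f+g)=\rho(f)+\rho(g)$; and $\rho(f+c)=\rho(f)+\rho(c)$ for every constant $c$. $\|\rho\|=\sup\{|\rho(f)|: f \text{ in the domain},\ \|f\|\le1\}$. For a functional $\rho$ that is either a p-conic quasi-linear functional on $C_0(X)$ or $C_0^+(X)$, or (when $X$ is compact) an r-functional on $C(X)$, $\mu_\rho(U)=\sup\{\rho(f): f\in C_c(X), 0\le f\le1, \operatorname{supp} f\subseteq U\}$ for $U$ open, and $\mu_\rho(F)=\inf\{\mu_\rho(U):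 F\subseteq U\in\mathscr{O}(X)\}$ for $F$ closed. For a finite deficient topological measure $\mu$ and $f\in C_b(X)$, let $R_1(t)=\mu(f^{-1}((t,\infty)))$, $t\in\mathbb{R}$, and let $r=r_{f,\mu}$ be the Lebesgue–Stieltjes measure on $\mathbb{R}$ associated with the non-decreasing right-continuous function $-R_1$. Then $\mathcal{R}_\mu(f)=\int_{\mathbb{R}} t\,dr(t)$. (Equivalently $\mathcal{R}_\mu(f)=\int_a^b R_1(t)\,dt+a\mu(X)$ whenever $f(X)\subseteq[a,b]$.) *)

(* Defs.v *)
From HB Require Import structures.
From mathcomp Require Import all_boot all_order all_algebra.
From mathcomp Require Import all_classical all_reals all_analysis.
Import Order.TTheory GRing.Theory Num.Theory.
Import numFieldNormedType.Exports.
Set Implicit Arguments.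
Unset Strict Implicit.
Unset Printing Implicit Defensive.
Local Open Scope classical_set_scope.
Local Open Scope ring_scope.
Local Open Scope ereal_scope.

Section function_spaces.
Context {R : realType} {X : topologicalType}.
Implicit Types f : X -> R.

Definition supp f : set X := closure [set x | f x != 0%R].

Definition supnorm f : \bar R := ereal_sup [set `|f x|%:E | x in [set: X]].

Definition C_all : set (X -> R) := [set f | continuous f].

Definition C_0 : set (X -> R) :=
  [set f | continuous f /\
     forall e : R, (0 < e)%R ->
       exists2 K : set X, compact K & forall x, ~ K x -> (`|f x| < e)%R].

Definition C_c : set (X -> R) := [set f | continuous f /\ compact (supp f)].

Definition C_0_plus : set (X -> R) :=
  [set f | C_0 f /\ forall x, (0 <= f x)%R].

(* phi is only relevant on the closure of f(X). *)
Definition A_plus f : set (X -> R) :=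
  [set g | exists phi : R -> R,
    [/\ {within closure (range f), continuous phi},
        {in closure (range f) &, {homo phi : s t / (s <= t)%R}},
        ~ compact [set: X] -> phi 0%R = 0%R
      & g = phi \o f]].

End function_spaces.
Arguments C_all {R X}.
Arguments C_0 {R X}.
Arguments C_c {R X}.
Arguments C_0_plus {R X}.

Section deficient_topological_measure.
Context {R : realType} {X : topologicalType}.

(* Set functions are defined on all subsets of X, but only their values on
   open and on closed sets are ever constrained or used. *)
Record deficient_topological_measure (nu : set X -> \bar R) : Prop := {
  dtm_ge0 : forall A, open A \/ closed A -> 0 <= nu A ;
  dtm_additive : forall C K, compact C -> compact K -> C `&` K = set0 ->
    nu (C `|` K) = nu C + nu K ;
  dtm_inner : forall U, open U ->
    nu U = ereal_sup [set nu C | C in [set C | compact C /\ C `<=` U]] ;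
  dtm_outer : forall F, closed F ->
    nu F = ereal_inf [set nu U | U in [set U | open U /\ F `<=` U]] }.

Record finite_dtm (nu : set X -> \bar R) : Prop := {
  finite_dtm_dtm : deficient_topological_measure nu ;
  finite_dtm_lty : nu setT < +oo }.

End deficient_topological_measure.

(* A functional on D is an extended-real function on X -> R of which only the
   values on D matter; equality of functionals on D means equality on D. *)
Section functionals.
Context {R : realType} {X : topologicalType}.
Implicit Types (D : set (X -> R)) (rho : (X -> R) -> \bar R).

Record functional_on D rho : Prop := {
  functional_one_infinity :
    (forall f, D f -> rho f != +oo) \/ (forall f, D f -> rho f != -oo) ;
  functional_not_pinfty : exists2 f, D f & rho f != +oo ;
  functional_not_ninfty : exists2 f, D f & rho f != -oo }.

(* For D = C_0 or D = C_0_plus. *)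
Record p_conic_quasi_linear D rho : Prop := {
  p_conic_functional : functional_on D rho ;
  p_conic_fin0 : rho (cst 0%R) \is a fin_num ;
  p_conic_orthogonal : forall f g : X -> R, D f -> D g ->
    (forall x, (f x * g x = 0)%R) ->
    (forall x, (0 <= f x)%R) -> (forall x, (0 <= g x)%R) ->
    rho (f \+ g)%R = rho f + rho g ;
  p_conic_monotone : forall f g : X -> R, D f -> D g ->
    (forall x, (0 <= g x)%R) -> (forall x, (g x <= f x)%R) ->
    rho g <= rho f ;
  p_conic_linear : forall f : X -> R, C_0 f ->
    forall g h : X -> R, A_plus f g -> D g -> A_plus f h -> D h ->
    forall a b : R, (0 <= a)%R -> (0 <= b)%R ->
    rho (fun x => a * g x + b * h x)%R = a%:E * rho g + b%:E * rho h }.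

(* For compact X; the domain is then the space of all continuous functions. *)
Record r_functional rho : Prop := {
  r_fun_functional : functional_on C_all rho ;
  r_fun_fin0 : rho (cst 0%R) \is a fin_num ;
  r_fun_homogeneous : forall (f : X -> R) (a : R), continuous f -> (0 < a)%R ->
    rho (fun x => a * f x)%R = a%:E * rho f ;
  r_fun_monotone : forall f g : X -> R, continuous f -> continuous g ->
    (forall x, (0 <= g x)%R) -> (forall x, (g x <= f x)%R) ->
    rho g <= rho f ;
  r_fun_orthogonal : forall f g : X -> R, continuous f -> continuous g ->
    (forall x, (f x * g x = 0)%R) ->
    ((forall x, (0 <= f x)%R) /\ (forall x, (0 <= g x)%R)) \/
    ((forall x, (0 <= f x)%R) /\ (forall x, (g x <= 0)%R)) ->
    rho (f \+ g)%R = rho f + rho g ;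
  r_fun_constant : forall (f : X -> R) (c : R), continuous f ->
    rho (fun x => f x + c)%R = rho f + rho (cst c) }.

Definition real_valued D rho := forall f, D f -> rho f \is a fin_num.

Definition functional_norm D rho : \bar R :=
  ereal_sup [set `|rho f| | f in [set f | D f /\ supnorm f <= 1]].

Definition mu_open rho (U : set X) : \bar R :=
  ereal_sup [set rho f | f in
    [set f | [/\ C_c f, forall x, (0 <= f x <= 1)%R & supp f `<=` U]]].

Definition mu_closed rho (F : set X) : \bar R :=
  ereal_inf [set mu_open rho U | U in [set U | open U /\ F `<=` U]].

(* mu = mu_rho as set functions on the open and the closed subsets of X. *)
Definition eq_mu_of (mu : set X -> \bar R) rho :=
  (forall U, open U -> mu U = mu_open rho U) /\
  (forall F, closed F -> mu F = mu_closed rho F).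

End functionals.

Section integral.
Context {R : realType} {X : topologicalType}.

(* Junk value idfun when g is not cumulative; R1_cumulative rules this out
   where cumul_of is used below. *)
Definition cumul_of (g : R -> R) : cumulative R R :=
  match pselect (nondecreasing g /\ right_continuous g) with
  | left h => HB.pack_for (cumulative R R) g
                (isCumulative.Build R _ R g h.1 h.2)
  | right _ => idfun
  end.

Lemma cumul_ofE (g : R -> R) :
  nondecreasing g -> right_continuous g -> cumul_of g = g :> (R -> R).
Proof. by move=> nd rc; rewrite /cumul_of; case: pselect => // -[]. Qed.

Definition R1 (mu : set X -> \bar R) (f : X -> R) (t : R) : R :=
  fine (mu (f @^-1` `]t, +oo[)).

Lemma R1_cumulative (mu : set X -> \bar R) (f : X -> R) :
  finite_dtm mu -> continuous f ->
  nondecreasing (fun t => - R1 mu f t)%R /\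
  right_continuous (fun t => - R1 mu f t)%R.
Proof.
move=> [[mu0 _ muI _] muT] cf.
have oU t : open (f @^-1` `]t, +oo[) by apply: open_comp => // x _; exact: cf.
have mono A B : open A -> open B -> A `<=` B -> mu A <= mu B.
  move=> oA oB AB; rewrite (muI A oA) (muI B oB); apply: ge_ereal_sup.
  move=> _ [C [cC CA] <-]; apply: ereal_sup_ubound; exists C => //.
  by split => //; exact: subset_trans AB.
have mufin t : mu (f @^-1` `]t, +oo[) \is a fin_num.
  rewrite ge0_fin_numE; last by apply: mu0; left.
  by apply: le_lt_trans muT; apply: mono => //; exact: openT.
have nd s t : (s <= t)%R -> (R1 mu f t <= R1 mu f s)%R.
  move=> st; rewrite /R1 fine_le//; apply: mono => // x /=.
  by rewrite !in_itv/= !andbT; exact: le_lt_trans.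
split=> [s t st|t]; first by rewrite lerN2; exact: nd.
apply: cvgN; apply/cvgrPdist_le => e e0.
have := mufin t; rewrite muI// => /(ub_ereal_sup_adherent e0)[_ [C [cC CU] <-]].
rewrite -muI// => muC.
have [m tm mC] : exists2 m, (t < m)%R & forall x, C x -> (m <= f x)%R.
  have [->|/set0P C0] := eqVneq C set0; first by exists (t + 1)%R; rewrite ?ltrDl.
  have [|c /set_mem Cc cmin] := compact_EVT_min C0 cC (f := f).
    exact: continuous_subspaceT.
  exists (f c); first by have := CU _ Cc; rewrite /= in_itv/= andbT.
  by move=> x Cx; apply: cmin; exact: mem_set.
near=> s.
have ts : (t < s)%R by near: s; exact: nbhs_right_gt.
have sm : (s < m)%R by near: s; exact: nbhs_right_lt.
rewrite ger0_norm; last by rewrite subr_ge0; apply: nd; exact: ltW.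
rewrite lerBlDr addrC -lerBlDr.
rewrite -lee_fin EFinB /R1 !fineK//; apply/ltW/(lt_le_trans muC).
rewrite (muI (f @^-1` `]s, +oo[))//; apply: ereal_sup_ubound; exists C => //.
split => // x Cx /=; rewrite in_itv/= andbT; apply: lt_le_trans sm _.
exact: mC.
Unshelve. all: by end_near. Qed.

Definition r_measure (mu : set X -> \bar R) (f : X -> R) :=
  lebesgue_stieltjes_measure (cumul_of (fun t => - R1 mu f t)%R).

Definition R_functional (mu : set X -> \bar R) (f : X -> R) : \bar R :=
  \int[r_measure mu f]_t (t : R)%:E.

End integral.

(* Main.v *)
Require Import Defs.
From HB Require Import structures.
From mathcomp Require Import all_boot all_order all_algebra.
From mathcomp Require Import all_classical all_reals all_analysis.
From mathcomp Require Import measurable_realfun lra.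
Import Order.TTheory GRing.Theory Num.Theory.
Import numFieldNormedType.Exports.
Set Implicit Arguments.
Unset Strict Implicit.
Unset Printing Implicit Defensive.
Local Open Scope classical_set_scope.
Local Open Scope ring_scope.
Local Open Scope ereal_scope.

(** A functional that can be cut along the levels of a function is determined
by the masses of the superlevel sets. For [f >= 0] and a mesh [h] write
[f = sum_k f_k] with [f_k = min ((f - k h)^+) h]. If the functional [rho] is
additive along such cuts, then [rho f = sum_k rho f_k]; and since [f_k] equals
[h] where [f > (k + 1) h] and vanishes where [f <= k h], monotonicity and the
definition of [mu_rho] squeeze [rho f_k] between [h] times the masses of
neighbouring superlevel sets. Hence [rho f] differs by at most [h * mu X] from
[level_sum f h n = sum_(k < n) h * mu {f > k h}], a quantity that depends only
on [mu] and [f]. The record [layered] collects what this argument uses, and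
[layered_level_sum] is the resulting estimate. Letting [h] tend to [0] gives
uniqueness ([layered_unique]), and also monotonicity ([layered_le]) and
additivity on orthogonal functions ([layered_orthogonal]), because the
superlevel sets have these properties.

Both kinds of functionals in the theorem are layered. For a p-conic
quasi-linear one, [min f c] and [(f - c)^+] lie in [A_plus f]
([p_conic_layered]). For an r-functional, [f - c] is the orthogonal sum of
[(f - c)^+ >= 0] and [min f c - c <= 0], and the constant [c] can be moved in
and out ([r_functional_layered]); a continuous function on a compact space is
made nonnegative by adding a constant ([r_functional_unique]).

For existence, the Stieltjes measure of [phi \o f] is the image under [phi] of
the one of [f] whenever [phi] is continuous and non-decreasing, because
superlevel sets of [phi] are rays ([r_measure_comp]). So
[R_functional mu (phi \o f)] is the integral of [phi] against the measure of
[f] ([R_functional_comp]), which is linear in [phi]. This gives the linearity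
on [A_plus f], where connectedness of [X] lets [phi] be extended from the
closure of the range of [f] to the whole line ([A_plus_extension]), as well as
homogeneity, invariance under constants and the cutting property; together
with Markov's inequality the functional is layered
([R_functional_layered]). Finally, Urysohn functions with compact support turn
the bounds defining a layered functional into [mu = mu_rho] and into the value
of the norm ([layered_eq_mu], [layered_norm]). *)

(** * Superlevel sets and finite deficient topological measures *)

Lemma open_superlevel {R : realType} {X : topologicalType} (f : X -> R) t :
  continuous f -> open (f @^-1` `]t, +oo[).
Proof. by move=> cf; apply: open_comp => // x _; exact: cf. Qed.

Section dtm_basics.
Context {R : realType} {X : topologicalType} (mu : set X -> \bar R).
Hypothesis hmu : finite_dtm mu.
Let dmu := finite_dtm_dtm hmu.

Lemma dtm_le_open (A B : set X) : open A -> open B -> A `<=` B -> mu A <= mu B.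
Proof.
move=> oA oB AB; rewrite (dtm_inner dmu oA) (dtm_inner dmu oB).
apply: ge_ereal_sup => _ [C [cC CA] <-]; apply: ereal_sup_ubound; exists C => //.
by split => //; exact: subset_trans AB.
Qed.

Lemma dtm_le_compact (C U : set X) :
  compact C -> open U -> C `<=` U -> mu C <= mu U.
Proof.
move=> cC oU CU; rewrite (dtm_inner dmu oU).
by apply: ereal_sup_ubound; exists C.
Qed.

Lemma dtm_fin_open (U : set X) : open U -> mu U \is a fin_num.
Proof.
move=> oU; rewrite ge0_fin_numE; last by apply: (dtm_ge0 dmu); left.
by apply: le_lt_trans (finite_dtm_lty hmu); apply: dtm_le_open => //; exact: openT.
Qed.

Lemma dtm_set0 : mu set0 = 0.
Proof.
have /esym := dtm_additive dmu (@compact0 X) (@compact0 X) (setI0 set0).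
rewrite setU0; have := dtm_fin_open open0; case: (mu set0) => // r _.
by rewrite -EFinD => -[] /eqP; rewrite -subr_eq0 addrK => /eqP ->.
Qed.

(** A compact subset of the union is the disjoint union of two compact pieces,
each obtained by removing the other open set; so additivity on compact sets
passes to open sets through inner regularity. *)
Lemma dtm_additive_open (U V : set X) : open U -> open V -> U `&` V = set0 ->
  mu (U `|` V) = mu U + mu V.
Proof.
move=> oU oV UV0; have oUV := openU oU oV.
have UVF x : U x -> V x -> False by move=> Ux Vx; rewrite -[False]/(set0 x) -UV0.
apply/eqP; rewrite eq_le; apply/andP; split.
  rewrite (dtm_inner dmu oUV); apply: ge_ereal_sup => _ [C [cC CUV] <-].
  have cCD W : open W -> compact (C `&` ~` W).
    by move=> oW; apply: compact_closedI => //; exact: open_closedC.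
  rewrite (_ : C = (C `&` ~` V) `|` (C `&` ~` U)); last first.
    apply/seteqP; split=> [x Cx|x [[]|[]]//].
    by case: (CUV _ Cx) => ?; [left|right]; split => // ?; exact: (UVF x).
  rewrite (dtm_additive dmu) ?leeD//; try exact: cCD.
  - by apply: dtm_le_compact => //; [exact: cCD|move=> x [Cx]; case: (CUV x Cx)].
  - by apply: dtm_le_compact => //; [exact: cCD|move=> x [Cx]; case: (CUV x Cx)].
  - by rewrite -subset0 => x [[Cx nV] [_ nU]]; case: (CUV x Cx).
have Ufin := dtm_fin_open oU; have Vfin := dtm_fin_open oV.
apply/lee_addgt0Pr => e e0; have e2 : (0 < e / 2)%R by rewrite divr_gt0.
have near W : open W -> exists2 C, compact C /\ C `<=` W &
    mu W <= mu C + (e / 2)%:E /\ mu C \is a fin_num.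
  move=> oW; have := dtm_fin_open oW.
  rewrite {1}(dtm_inner dmu oW) => /(ub_ereal_sup_adherent e2)[_ [C [cC CW] <-]].
  rewrite -(dtm_inner dmu oW) => ltC; exists C => //; split.
    by rewrite -leeBlDr//; exact: ltW.
  rewrite fin_numElt (le_lt_trans (dtm_le_compact cC oW CW)); last first.
    by rewrite ltey_eq dtm_fin_open.
  rewrite (le_lt_trans _ ltC)// leNye //.
have [C [cC CU] [leC Cfin]] := near _ oU.
have [D [cD DV] [leD Dfin]] := near _ oV.
rewrite (le_trans (leeD leC leD))//.
have -> : e%:E = (e / 2)%:E + (e / 2)%:E by rewrite -EFinD -splitr.
rewrite addeACA -(dtm_additive dmu)//; last first.
  by rewrite -subset0 => x [/CU Ux /DV Vx]; exact: (UVF x).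
rewrite leeD2r//; apply: dtm_le_compact => //; first exact: compactU.
exact: setUSS.
Qed.

Lemma R1E f t : continuous f -> (R1 mu f t)%:E = mu (f @^-1` `]t, +oo[).
Proof.
move=> cf; rewrite /R1 fineK// dtm_fin_open//.
exact: open_superlevel.
Qed.

Lemma R1_ge0 f t : continuous f -> (0 <= R1 mu f t)%R.
Proof.
move=> cf; rewrite -lee_fin R1E//; apply: (dtm_ge0 dmu); left; exact: open_superlevel.
Qed.

Lemma dtm_fineT : (fine (mu setT))%:E = mu setT.
Proof. by rewrite fineK// dtm_fin_open//; exact: openT. Qed.

Lemma R1_leT f t : continuous f -> (R1 mu f t <= fine (mu setT))%R.
Proof.
move=> cf; rewrite -lee_fin R1E// dtm_fineT; apply: dtm_le_open => //.
  exact: open_superlevel.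
exact: openT.
Qed.

End dtm_basics.

(** * The cone of nonnegative functions vanishing at infinity *)

Section nonnegative_cone.
Context {R : realType} {X : topologicalType}.
Implicit Types f g : X -> R.
Local Open Scope ring_scope.

Lemma C_0_bounded f : C_0 f -> exists2 N : R, 0 <= N & forall x, `|f x| <= N.
Proof.
move=> [cf /(_ _ ltr01)[K cK Kf]].
have [K0|/set0P K0] := eqVneq K set0.
  by exists 1 => // x; apply/ltW/Kf; rewrite K0.
have [|c _ cmax] := compact_EVT_max K0 cK (f := fun x => `|f x|).
  by apply: continuous_subspaceT => x; apply: cvg_norm; exact: cf.
exists (Num.max 1 `|f c|); first by rewrite le_max ler01.
move=> x; rewrite le_max; have [Kx|/Kf/ltW->//] := pselect (K x).
by rewrite cmax ?orbT// inE.
Qed.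

Lemma C_0_plus_dominated f g : C_0_plus f -> continuous g ->
  (forall x, 0 <= g x <= f x) -> C_0_plus g.
Proof.
move=> [[cf f0] fge0] cg gf; split; last by move=> x; case/andP: (gf x).
split => // e /f0[K cK Kf]; exists K => // x /Kf; apply: le_lt_trans.
by case/andP: (gf x) => g0 gle; rewrite !ger0_norm// (le_trans g0).
Qed.

Lemma C_0_plusZ f (a : R) : 0 <= a -> C_0_plus f -> C_0_plus (fun x => a * f x).
Proof.
move=> a0 [[cf f0] fge0]; split; last by move=> x; rewrite mulr_ge0.
split; first by move=> x; apply: cvgM; [exact: cvg_cst|exact: cf].
move=> e e0; have [K cK Kf] : exists2 K : set X, compact K &
    forall x, ~ K x -> `|f x| < e / (a + 1).
  by apply: f0; rewrite divr_gt0// ltr_wpDl.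
exists K => // x /Kf fx; rewrite normrM (ger0_norm a0).
rewrite (le_lt_trans (y := (a + 1) * `|f x|))//.
  by rewrite ler_wpM2r// lerDl.
by rewrite mulrC -ltr_pdivlMr// ltr_wpDl.
Qed.

Lemma C_0_plusD f g : C_0_plus f -> C_0_plus g -> C_0_plus (f \+ g).
Proof.
move=> [[cf f0] fge0] [[cg g0] gge0]; split; last by move=> x; rewrite addr_ge0.
split; first by move=> x; apply: cvgD; [exact: cf|exact: cg].
move=> e e0; have e2 : 0 < e / 2 by rewrite divr_gt0.
have [K cK Kf] := f0 _ e2; have [L cL Lg] := g0 _ e2.
exists (K `|` L); first exact: compactU.
move=> x /not_orP[/Kf fx /Lg gx]; rewrite (le_lt_trans (ler_normD _ _))//.
by rewrite (splitr e) ltrD.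
Qed.

Lemma C_0_plus_cst0 : C_0_plus (cst 0 : X -> R).
Proof.
split=> //; split; first by move=> x; exact: cvg_cst.
by move=> e e0; exists set0; [exact: compact0|move=> x _; rewrite normr0].
Qed.

Lemma continuous_minc f (c : R) : continuous f ->
  continuous (fun x => Num.min (f x) c).
Proof. by move=> cf x; apply: continuous_min; [exact: cf|exact: cvg_cst]. Qed.

Lemma continuous_excess f (c : R) : continuous f ->
  continuous (fun x => Num.max (f x - c) 0).
Proof.
move=> cf x; apply: (@continuous_max _ _ (fun x => f x - c)); last exact: cvg_cst.
by apply: cvgB; [exact: cf|exact: cvg_cst].
Qed.

Lemma C_0_plus_minc f (c : R) : 0 <= c -> C_0_plus f ->
  C_0_plus (fun x => Num.min (f x) c).
Proof.
move=> c0 Df; apply: C_0_plus_dominated (Df) _ _.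
  by apply: continuous_minc; exact: Df.1.1.
by move=> x; rewrite le_min c0 ge_min lexx Df.2.
Qed.

Lemma C_0_plus_excess f (c : R) : 0 <= c -> C_0_plus f ->
  C_0_plus (fun x => Num.max (f x - c) 0).
Proof.
move=> c0 Df; apply: C_0_plus_dominated (Df) _ _.
  by apply: continuous_excess; exact: Df.1.1.
by move=> x; rewrite le_max lexx orbT ge_max Df.2 gerBl c0.
Qed.

Lemma nonzero_in_supp f x : f x != 0 -> supp f x.
Proof. by move=> fx; apply: (@subset_closure _ [set x | f x != 0]). Qed.

Lemma supp_subset f (A : set X) : closed A -> (forall x, f x != 0 -> A x) ->
  supp f `<=` A.
Proof. by move=> clA fA; rewrite /supp closureE; apply: smallest_sub. Qed.

Lemma closed_superlevel f (c : R) : continuous f -> closed [set x | c <= f x].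
Proof.
move=> cf; rewrite (_ : mkset _ = f @^-1` [set y | c <= y])//.
by apply: closed_comp => //; exact: closed_ge.
Qed.

Lemma C_0_plus_compact_ge f (c : R) : 0 < c -> C_0_plus f ->
  compact [set x | c <= f x].
Proof.
move=> c0 [[cf f0] _]; have [K cK Kf] := f0 _ c0.
apply: subclosed_compact cK _; first exact: closed_superlevel.
move=> x /= cfx; apply: contrapT => /Kf; rewrite ltNge.
by rewrite (le_trans cfx)// ler_norm.
Qed.

Lemma C_c_plus f : C_c f -> (forall x, 0 <= f x) -> C_0_plus f.
Proof.
move=> [cf sf] f0; split => //; split => // e e0; exists (supp f) => // x nsx.
have [-> |/nonzero_in_supp//] := eqVneq (f x) 0.
by rewrite normr0.
Qed.

End nonnegative_cone.

(** * Layered functionals and level sums *)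

Section layered_functionals.
Context {R : realType} {X : topologicalType} (mu : set X -> \bar R).

(** The common ground of p-conic quasi-linear functionals, r-functionals and
[R_functional mu]: on nonnegative functions they can be cut at any level
([layered_split]) and are controlled by [mu] on functions that are large on an
open set or small and supported in one. *)
Record layered (rho : (X -> R) -> \bar R) : Prop := {
  layered_fin : forall f, C_0_plus f -> rho f \is a fin_num ;
  layered_split : forall (f : X -> R) (c : R), C_0_plus f -> (0 < c)%R ->
    rho f = rho (fun x => Num.min (f x) c)
            + rho (fun x => Num.max (f x - c) 0)%R ;
  layered_lower : forall (f : X -> R) (U : set X) (h : R),
    C_0_plus f -> open U -> (0 < h)%R -> (forall x, U x -> (h <= f x)%R) ->
    h%:E * mu U <= rho f ;
  layered_upper : forall (f : X -> R) (U : set X) (h : R),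
    C_c f -> (forall x, 0 <= f x)%R -> open U -> (0 < h)%R ->
    (forall x, (f x <= h)%R) -> supp f `<=` U ->
    rho f <= h%:E * mu U ;
  layered_upperT : forall (f : X -> R) (h : R),
    C_0_plus f -> (0 < h)%R -> (forall x, (f x <= h)%R) ->
    rho f <= h%:E * mu setT }.

Hypothesis hmu : finite_dtm mu.

(** The Riemann sum of [t |-> mu {f > t}] with mesh [h]. *)
Definition level_sum (f : X -> R) (h : R) (n : nat) : R :=
  (\sum_(k < n) h * R1 mu f (k%:R * h))%R.

Lemma R1_excess (f : X -> R) (h t : R) : (0 <= t)%R ->
  R1 mu (fun x => Num.max (f x - h) 0)%R t = R1 mu f (t + h)%R.
Proof.
move=> t0; rewrite /R1; congr (fine (mu _)); apply/seteqP; split=> x /=;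
  rewrite !in_itv/= !andbT lt_max ltrBrDr ?(ltNge t) ?t0 ?orbF//.
Qed.

Variable rho : (X -> R) -> \bar R.
Hypothesis Lrho : layered rho.

Lemma layered_ge0 f : C_0_plus f -> 0 <= rho f.
Proof.
move=> Df; have := layered_lower Lrho Df open0 ltr01 (fun x => False_ind _).
by rewrite dtm_set0// mule0.
Qed.

Lemma layered_lower_R1 (f : X -> R) (h : R) : C_0_plus f -> (0 < h)%R ->
  (h * R1 mu f h)%:E <= rho (fun x => Num.min (f x) h).
Proof.
move=> Df h0; have cf := Df.1.1; rewrite EFinM R1E//.
apply: (layered_lower Lrho) => //.
- exact/C_0_plus_minc/Df/ltW.
- exact: open_superlevel.
- by move=> x /=; rewrite in_itv/= andbT le_min lexx andbT => /ltW.
Qed.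

(** The layer just above [h] has compact support inside [{F > 0}]. A layer
[min F h] starting at level [0] need not have compact support, which is why
it is treated apart, through [layered_upperT]. *)
Lemma layered_upper_R1 (F : X -> R) (h : R) : C_0_plus F -> (0 < h)%R ->
  rho (fun x => Num.min (Num.max (F x - h) 0) h)%R <= (h * R1 mu F 0)%:E.
Proof.
move=> DF h0; have cF := DF.1.1; rewrite EFinM R1E//.
set g := (fun x => _).
have suppg : supp g `<=` [set x | (h <= F x)%R].
  apply: supp_subset => [|x]; first exact: closed_superlevel.
  apply: contra_neqT; rewrite /= -ltNge /g => Fh.
  by rewrite max_r ?min_l ?subr_le0// ltW.
have Dg : C_0_plus g by do ![apply: C_0_plus_minc|apply: C_0_plus_excess]; rewrite // ltW.
apply: (layered_upper Lrho) => //.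
- split; first exact: Dg.1.1.
  apply: subclosed_compact (C_0_plus_compact_ge h0 DF) suppg.
  exact: closed_closure.
- by move=> x; exact: Dg.2.
- exact: open_superlevel.
- by move=> x; rewrite /g ge_min lexx orbT.
- by move=> x /suppg /=; rewrite in_itv/= andbT; exact: lt_le_trans.
Qed.

(** Induction on the number of layers: removing the bottom layer replaces [f]
by [(f - h)^+], whose superlevel sets are those of [f] shifted by [h]. *)
Lemma level_sum_lower n (f : X -> R) (h : R) :
  C_0_plus f -> (0 < h)%R -> (forall x, f x <= n%:R * h)%R ->
  (\sum_(k < n) h * R1 mu f (k.+1%:R * h))%:E%R <= rho f.
Proof.
move=> Df h0; elim: n f Df => [|n IH] f Df fn.
  by rewrite big_ord0; exact: layered_ge0.
rewrite big_ord_recl (layered_split Lrho Df h0) EFinD leeD//.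
  by rewrite mul1r; exact: layered_lower_R1.
apply: le_trans (IH _ _ _); last 2 first.
- by apply: C_0_plus_excess => //; exact: ltW.
- move=> x; rewrite ge_max (mulr_ge0 (ler0n _ n) (ltW h0)) andbT lerBlDr.
  by rewrite -[X in (_ <= _ + X)%R]mul1r -mulrDl natr1.
rewrite lee_fin ler_sum// => i _; rewrite R1_excess ?mulr_ge0 ?(ltW h0)//.
by rewrite -[X in (_ + X)%R]mul1r -mulrDl natr1.
Qed.

(** The induction peels the layers off [F] from below, so that each layer is
seen as the one directly above level [h] of a function in the cone. *)
Lemma level_sum_excess_upper n (F : X -> R) (h : R) :
  C_0_plus F -> (0 < h)%R -> (forall x, F x <= n.+1%:R * h)%R ->
  rho (fun x => Num.max (F x - h) 0)%R <= (level_sum F h n)%:E.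
Proof.
move=> DF h0; rewrite /level_sum; elim: n F DF => [|n IH] F DF Fn.
  rewrite big_ord0.
  have -> : (fun x => Num.max (F x - h) 0)%R = cst 0%R.
    by apply/funext => x; apply: max_r; rewrite subr_le0 -[h]mul1r.
  have sz : supp (cst 0%R : X -> R) `<=` set0.
    by apply: supp_subset => [|x]; [exact: closed0|rewrite eqxx].
  have := layered_upper Lrho (f := cst 0%R) (U := set0) (h := 1%R).
  rewrite dtm_set0// mule0; apply => //; last exact: open0.
  split; first by move=> x; exact: cvg_cst.
  by rewrite (_ : supp _ = set0); [exact: compact0|rewrite -subset0].
have DG : C_0_plus (fun x => Num.max (F x - h) 0)%R.
  by apply: C_0_plus_excess => //; exact: ltW.
rewrite big_ord_recl (layered_split Lrho DG h0) EFinD leeD//.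
  by rewrite mul0r; exact: layered_upper_R1.
apply: le_trans (IH _ DG _) _.
  move=> x; rewrite ge_max (mulr_ge0 (ler0n _ n.+1) (ltW h0)) andbT lerBlDr.
  by rewrite -[X in (_ <= _ + X)%R]mul1r -mulrDl natr1.
rewrite lee_fin ler_sum// => i _; rewrite R1_excess ?mulr_ge0 ?(ltW h0)//.
by rewrite -[X in (_ + X)%R]mul1r -mulrDl natr1.
Qed.

(** The lower bound above is the level sum with its first term replaced by a
nonnegative last one, and the upper bound misses only the bottom layer; both
defects are at most [h * mu X]. *)
Lemma layered_level_sum n (f : X -> R) (h : R) :
  C_0_plus f -> (0 < h)%R -> (forall x, f x <= n%:R * h)%R ->
  (level_sum f h n - h * fine (mu setT) <= fine (rho f)
    <= level_sum f h n + h * fine (mu setT))%R.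
Proof.
move=> Df h0 fn; have cf := Df.1.1; have rf := layered_fin Lrho Df.
apply/andP; split; rewrite -lee_fin fineK//.
  apply: le_trans (level_sum_lower Df h0 fn); rewrite lee_fin /level_sum.
  case: n {fn} => [|n].
    rewrite !big_ord0 sub0r oppr_le0 mulr_ge0 ?(ltW h0)//.
    by rewrite (le_trans (R1_ge0 hmu 0 cf))// R1_leT.
  rewrite big_ord_recl [leRHS]big_ord_recr/=.
  have R1T := R1_leT hmu (0%:R * h)%R cf.
  have := R1_ge0 hmu (n.+1%:R * h)%R cf.
  move: (R1 mu f _) R1T (R1 mu f _) => a aT b b0.
  set s := (\sum_(i < n) _)%R.
  have := ler_wpM2l (ltW h0) aT; have := mulr_ge0 (ltW h0) b0; lra.
rewrite (layered_split Lrho Df h0) addeC EFinD leeD//.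
  apply: level_sum_excess_upper => // x; rewrite (le_trans (fn x))//.
  by rewrite ler_wpM2r ?(ltW h0)// ler_nat.
rewrite EFinM dtm_fineT//; apply: (layered_upperT Lrho) => //.
  exact/C_0_plus_minc/Df/ltW.
by move=> x; rewrite ge_min lexx orbT.
Qed.

End layered_functionals.

(** An error proportional to the mesh disappears in the limit. *)
Lemma le_mesh {R : realType} (x y K : R) :
  (forall h, 0 < h -> x <= y + h * K)%R -> (x <= y)%R.
Proof.
move=> H; apply/ler_addgt0Pr => e e0.
have K0 : (0 < `|K| + 1)%R by rewrite ltr_wpDl.
rewrite (le_trans (H (e / (`|K| + 1))%R _)) ?divr_gt0// lerD2l.
rewrite (le_trans (ler_norm _))// normrM gtr0_norm ?divr_gt0//.
rewrite mulrAC ler_pdivrMr// ler_wpM2l ?(ltW e0)//; by rewrite lerDl.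
Qed.

Lemma mesh_count {R : realType} (N h : R) : (0 < h)%R ->
  exists n, (N <= n%:R * h)%R.
Proof.
move=> h0; exists (Num.bound `|N / h|%R); rewrite -ler_pdivrMr//.
by rewrite (le_trans (ler_norm _))// ltW// archi_boundP.
Qed.

Section layered_comparison.
Context {R : realType} {X : topologicalType} (mu : set X -> \bar R).
Hypothesis hmu : finite_dtm mu.
Variable rho : (X -> R) -> \bar R.
Hypothesis Lrho : layered mu rho.
Implicit Types f g : X -> R.

(** Level sums depend on a function only through the masses of its superlevel
sets; with [rho = rho'] this is monotonicity, with [f = g] uniqueness. *)
Lemma layered_le_R1 rho' f g : layered mu rho' -> C_0_plus f -> C_0_plus g ->
  (forall t, 0 <= t -> R1 mu g t <= R1 mu f t)%R -> rho' g <= rho f.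
Proof.
move=> Lrho' Df Dg gf.
rewrite -(fineK (layered_fin Lrho Df)) -(fineK (layered_fin Lrho' Dg)) lee_fin.
apply: (@le_mesh _ _ _ (fine (mu setT) *+ 2)) => h h0.
have [N _ fN] := C_0_bounded Df.1; have [M _ gM] := C_0_bounded Dg.1.
have [n Nn] := mesh_count (Num.max N M) h0.
move: Nn; rewrite ge_max => /andP[Nn Mn].
have /andP[lf uf] := layered_level_sum hmu Lrho (n := n) Df h0
  (fun x => le_trans (ler_norm _) (le_trans (fN x) Nn)).
have /andP[lg ug] := layered_level_sum hmu Lrho' (n := n) Dg h0
  (fun x => le_trans (ler_norm _) (le_trans (gM x) Mn)).
have : (level_sum mu g h n <= level_sum mu f h n)%R.
  by apply: ler_sum => i _; rewrite ler_wpM2l ?(ltW h0)// gf// mulr_ge0 ?(ltW h0).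
rewrite mulrnAr; lra.
Qed.

Lemma layered_le f g : C_0_plus f -> C_0_plus g ->
  (forall x, g x <= f x)%R -> rho g <= rho f.
Proof.
move=> Df Dg gf; apply: layered_le_R1 => // t _.
rewrite -lee_fin !R1E//; [|exact: Df.1.1|exact: Dg.1.1].
apply: dtm_le_open => //.
- exact/open_superlevel/Dg.1.1.
- exact/open_superlevel/Df.1.1.
- by move=> x /=; rewrite !in_itv/= !andbT => /lt_le_trans; apply.
Qed.

Lemma R1_orthogonal f g t : continuous f -> continuous g ->
  (forall x, f x * g x = 0)%R -> (0 <= t)%R ->
  R1 mu (f \+ g)%R t = (R1 mu f t + R1 mu g t)%R.
Proof.
move=> cf cg fg0 t0; apply: EFin_inj; rewrite EFinD !R1E//; last first.
  by move=> x; apply: cvgD; [exact: cf|exact: cg].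
have fg x : f x = 0%R \/ g x = 0%R.
  by have /eqP := fg0 x; rewrite mulf_eq0 => /orP[] /eqP ->; [left|right].
rewrite -dtm_additive_open//; last 3 first.
- exact: open_superlevel.
- exact: open_superlevel.
- rewrite -subset0 => x /=; rewrite !in_itv/= !andbT => -[].
  by case: (fg x) => ->; rewrite ?(ltNge _ 0%R) ?t0.
congr (mu _); apply/seteqP; split=> x /=; rewrite !in_itv/= !andbT;
  case: (fg x) => ->; rewrite ?add0r ?addr0 (ltNge _ 0%R) ?t0; by [left|right|case].
Qed.

Lemma layered_orthogonal f g : C_0_plus f -> C_0_plus g ->
  (forall x, f x * g x = 0)%R -> rho (f \+ g)%R = rho f + rho g.
Proof.
move=> Df Dg fg0; have Dfg := C_0_plusD Df Dg.
have := layered_fin Lrho Df; have := layered_fin Lrho Dg.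
have := layered_fin Lrho Dfg => /fineK <- /fineK <- /fineK <-.
rewrite -EFinD; congr EFin.
have [N _ fN] := C_0_bounded Df.1; have [M _ gM] := C_0_bounded Dg.1.
have [K _ fgK] := C_0_bounded Dfg.1.
suff key h : (0 < h)%R -> (`|fine (rho (f \+ g)%R) - (fine (rho f) + fine (rho g))|
   <= h * (fine (mu setT) *+ 3))%R.
  apply/eqP; rewrite -subr_eq0 -normr_le0; apply: le_mesh => h h0.
  by rewrite add0r; exact: key.
move=> h0; have [n] := mesh_count (Num.max K (Num.max N M)) h0.
rewrite !ge_max => /and3P[Kn Nn Mn].
have /andP[lf uf] := layered_level_sum hmu Lrho (n := n) Df h0
  (fun x => le_trans (ler_norm _) (le_trans (fN x) Nn)).
have /andP[lg ug] := layered_level_sum hmu Lrho (n := n) Dg h0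
  (fun x => le_trans (ler_norm _) (le_trans (gM x) Mn)).
have /andP[lfg ufg] := layered_level_sum hmu Lrho (n := n) Dfg h0
  (fun x => le_trans (ler_norm _) (le_trans (fgK x) Kn)).
have : (level_sum mu (f \+ g)%R h n = level_sum mu f h n + level_sum mu g h n)%R.
  rewrite /level_sum -big_split/=; apply: eq_bigr => i _.
  rewrite -mulrDr R1_orthogonal ?mulr_ge0 ?(ltW h0)//; [exact: Df.1.1|exact: Dg.1.1].
rewrite mulrnAr ler_norml; lra.
Qed.

End layered_comparison.

Lemma layered_unique {R : realType} {X : topologicalType}
    (mu : set X -> \bar R) (rho rho' : (X -> R) -> \bar R) :
  finite_dtm mu -> layered mu rho -> layered mu rho' ->
  forall f, C_0_plus f -> rho' f = rho f.
Proof.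
move=> hmu Lr Lr' f Df; apply/eqP; rewrite eq_le.
by rewrite (layered_le_R1 hmu Lr Lr') ?(layered_le_R1 hmu Lr' Lr).
Qed.

(** * The Stieltjes measure of a function *)

Section stieltjes_measure_of_a_function.
Context {R : realType} {X : topologicalType} (mu : set X -> \bar R).
Hypothesis hmu : finite_dtm mu.
Implicit Types (f : X -> R) (phi : R -> R).

Definition bounded_continuous f :=
  continuous f /\ exists N : R, forall x, (`|f x| <= N)%R.

Lemma r_measure_oc f (s t : R) : continuous f -> (s <= t)%R ->
  r_measure mu f `]s, t] = (R1 mu f s - R1 mu f t)%:E.
Proof.
move=> cf st; have [nd rc] := R1_cumulative hmu cf.
rewrite /r_measure /lebesgue_stieltjes_measure /measure_extension.
rewrite measurable_mu_extE/=; last exact: is_ocitv.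
by rewrite wlength_itv_bnd// cumul_ofE// opprK addrC.
Qed.

Lemma measure_bigcup_eventually_cst d (T : measurableType d)
    (m : {measure set T -> \bar R}) (F : (set T)^nat) (v : \bar R) :
  (forall n, measurable (F n)) -> nondecreasing_seq F ->
  (\forall n \near \oo, m (F n) = v) -> m (\bigcup_n F n) = v.
Proof.
move=> mF ndF Fv; apply: (cvg_unique _ (nondecreasing_cvg_mu mF _ ndF)) => //.
  exact: bigcup_measurable.
by apply: cvg_near_cst.
Qed.

Lemma R1_above f (N t : R) : (forall x, `|f x| <= N)%R -> (N <= t)%R ->
  R1 mu f t = 0%R.
Proof.
move=> fN Nt; rewrite /R1 (_ : _ @^-1` _ = set0) ?dtm_set0// -subset0 => x /=.
rewrite in_itv/= andbT ltNge (le_trans _ Nt)//.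
by rewrite (le_trans (ler_norm _)).
Qed.

Lemma r_measure_ray f (t : R) : bounded_continuous f ->
  r_measure mu f `]t, +oo[ = mu (f @^-1` `]t, +oo[).
Proof.
move=> [cf [N fN]]; rewrite -(R1E hmu t cf) itv_bndy_bigcup_BRight.
apply: measure_bigcup_eventually_cst => //.
  by move=> m n mn; apply/subsetPset/subset_itvl; rewrite bnd_simp lerD2l ler_nat.
near=> n; rewrite [LHS](r_measure_oc cf) ?lerDl// (@R1_above _ N (t + n%:R)) ?subr0//.
rewrite -lerBlDl; near: n; exact: nbhs_infty_ger.
Unshelve. all: by end_near. Qed.

Lemma r_measureT f : bounded_continuous f -> r_measure mu f setT = mu setT.
Proof.
move=> bf; have [cf [N fN]] := bf.
rewrite (_ : setT = \bigcup_n `](- n%:R)%R, +oo[%classic :> set R); last first.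
  apply/esym; rewrite -subTset => x _; exists (Num.bound `|x|) => //=.
  rewrite in_itv/= andbT ltrNl (le_lt_trans (ler_norm _))// normrN.
  exact: archi_boundP.
apply: measure_bigcup_eventually_cst => //.
  move=> m n mn; apply/subsetPset/subset_itvr.
  by rewrite bnd_simp lerN2 ler_nat.
near=> n; rewrite [LHS](r_measure_ray _ bf).
congr (mu _); apply/seteqP; split=> // x _ /=.
rewrite in_itv/= andbT ltrNl (le_lt_trans (ler_norm _))// normrN.
rewrite (le_lt_trans (fN x))//; near: n; exact: nbhs_infty_gtr.
Unshelve. all: by end_near. Qed.

(** Continuity makes [phi <= t] closed, so when it is a nonempty proper subset
its complement is the open ray above its supremum. *)
Lemma nondecreasing_superlevel phi (t : R) :
  continuous phi -> {homo phi : s u / (s <= u)%R} ->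
  [\/ phi @^-1` `]t, +oo[ = set0,
      phi @^-1` `]t, +oo[ = setT |
      exists s, phi @^-1` `]t, +oo[ = `]s, +oo[%classic].
Proof.
move=> cphi ndphi; pose A := [set u | (phi u <= t)%R].
have inE' u : (phi @^-1` `]t, +oo[) u <-> ~ A u.
  by rewrite /= in_itv/= andbT /A /= ltNge; split => /negP.
have [A0|/set0P A0] := eqVneq A set0.
  by apply: Or32; rewrite -subTset => u _; apply/inE'; rewrite A0.
have [ubA|nubA] := pselect (has_ubound A); last first.
  apply: Or31; rewrite -subset0 => u /inE' nAu; apply: nubA; exists u => v Av.
  rewrite leNgt; apply/negP => uv; apply: nAu.
  by apply: le_trans Av; exact/ndphi/ltW.
apply: Or33; exists (sup A).
have clA : closed A.
  rewrite (_ : A = phi @^-1` [set y | y <= t]%R)//.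
  by apply: closed_comp => //; exact: closed_le.
have As : A (sup A).
  by apply: clA; exact: closure_sup.
apply/seteqP; split=> u; rewrite inE' /= in_itv/= andbT ltNge.
  by move=> nAu; apply/negP => us; apply: nAu; exact: le_trans (ndphi _ _ us) As.
by move/negP => su Au; apply: su; exact: ub_le_sup.
Qed.

Lemma nondecreasing_norm_le phi (a b u : R) : {homo phi : s t / (s <= t)%R} ->
  (a <= u <= b)%R -> (`|phi u| <= Num.max `|phi b| `|phi a|)%R.
Proof.
move=> ndphi /andP[/ndphi l /ndphi r]; rewrite ler_norml; apply/andP; split.
  by apply: le_trans l; rewrite lerNl le_max -[`|phi a|%R]normrN ler_norm orbT.
by rewrite le_max (le_trans r)// ler_norm.
Qed.

Lemma bounded_continuous_comp f phi : bounded_continuous f ->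
  continuous phi -> {homo phi : s u / (s <= u)%R} ->
  bounded_continuous (phi \o f).
Proof.
move=> [cf [N fN]] cphi ndphi; split.
  by move=> x; apply: continuous_comp; [exact: cf|exact: cphi].
exists (Num.max `|phi N| `|phi (- N)|)%R => x.
by apply: nondecreasing_norm_le; rewrite // -ler_norml.
Qed.

(** The Stieltjes measure lives on [measurableTypeR R], a copy of the real line
that carries its own measurability display. *)
Lemma nondecreasing_measurable_cumul phi : {homo phi : s u / (s <= u)%R} ->
  measurable_fun [set: measurableTypeR R]
    (phi : measurableTypeR R -> measurableTypeR R).
Proof. exact: (@nondecreasing_measurable R setT phi measurableT). Qed.

Lemma pushforward_is_measure d1 d2 (T1 : measurableType d1)
    (T2 : measurableType d2) (m : {measure set T1 -> \bar R}) (h : T1 -> T2) :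
  measurable_fun setT h -> exists m2 : {measure set T2 -> \bar R},
    m2 = pushforward m h :> (set T2 -> \bar R).
Proof.
move=> mh.
by exists (measure_function_pushforward__canonical__measure_function_Measure m mh).
Qed.

(** The change of variables behind the linearity of [R_functional mu]: two
finite measures that agree on the open rays coincide, and the preimage of a
ray under [phi] is again a ray, up to the two degenerate cases. *)
Lemma r_measure_comp f phi : bounded_continuous f ->
  continuous phi -> {homo phi : s u / (s <= u)%R} ->
  forall A, measurable A ->
  r_measure mu (phi \o f) A = r_measure mu f (phi @^-1` A).
Proof.
move=> bf cphi ndphi A mA.
have bpf := bounded_continuous_comp bf cphi ndphi.
have mphi := nondecreasing_measurable_cumul ndphi.
have [m2 m2E] := pushforward_is_measure (r_measure mu f) mphi.
pose m1 : {measure set (measurableTypeR R) -> \bar R} := r_measure mu (phi \o f).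
transitivity (m2 A); last by rewrite m2E.
rewrite -[LHS]/(m1 A).
have H := @measure_unique _ R (measurableTypeR R) (@RGenOInfty.G R)
  (fun n => `](- n%:R)%R, +oo[%classic) _ _ _ _ m1 m2.
apply: H mA => {A}.
- exact: RGenOInfty.measurableE.
- move=> _ _ [s ->] [t ->]; exists (Num.max s t); apply/seteqP; split=> x /=;
    rewrite !in_itv/= !andbT gt_max.
    by case=> -> ->.
  by move=> /andP[].
- by move=> n; exists (- n%:R)%R.
- rewrite -subTset => x _; exists (Num.bound `|x|) => //=.
  rewrite in_itv/= andbT ltrNl (le_lt_trans (ler_norm _))// normrN.
  exact: archi_boundP.
- move=> _ [t ->]; rewrite m2E /pushforward [LHS](r_measure_ray _ bpf) comp_preimage.
  have [->|->|[s ->]] := nondecreasing_superlevel t cphi ndphi.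
  + by rewrite preimage_set0 dtm_set0// measure0.
  + by rewrite preimage_setT [RHS](r_measureT bf).
  + by rewrite [RHS](r_measure_ray _ bf).
- move=> n; rewrite [ltLHS](r_measure_ray _ bpf) ltey_eq dtm_fin_open//.
  by apply: open_superlevel; exact: bpf.1.
Qed.

Definition clip (a b t : R) : R := Num.min (Num.max t a) b.

Lemma continuous_clip a b : continuous (clip a b).
Proof.
by apply: continuous_minc => t; apply: continuous_max; [exact: cvg_id|exact: cvg_cst].
Qed.

Lemma clip_nd a b : {homo clip a b : s t / (s <= t)%R}.
Proof. by move=> s t st; rewrite /clip le_min2// le_max2. Qed.

Lemma clip_in a b t : (a <= b)%R -> (a <= clip a b t <= b)%R.
Proof. by move=> ab; rewrite /clip le_min le_max lexx orbT ab ge_min lexx orbT. Qed.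

Lemma clip_id a b t : (a <= t <= b)%R -> clip a b t = t.
Proof. by move=> /andP[a_t tb]; rewrite /clip (max_l a_t) min_l. Qed.

Lemma clip_bounded_id f (N : R) : (forall x, `|f x| <= N)%R ->
  clip (- N) N \o f = f.
Proof. by move=> fN; apply/funext => x /=; rewrite clip_id// -ler_norml. Qed.

Lemma eq_integral_r_measure f phi (F : measurableTypeR R -> \bar R) :
  bounded_continuous f -> continuous phi -> {homo phi : s u / (s <= u)%R} ->
  \int[r_measure mu (phi \o f)]_t F t =
  \int[pushforward (r_measure mu f)
         (phi : measurableTypeR R -> measurableTypeR R)]_t F t.
Proof.
move=> bf cphi ndphi.
have [m2 m2E] := pushforward_is_measure (r_measure mu f)
  (nondecreasing_measurable_cumul ndphi).
rewrite -m2E; apply: (eq_measure_integral m2) => A mA _.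
by rewrite [LHS](r_measure_comp bf cphi ndphi mA) m2E.
Qed.

Lemma EFin_measurable_cumul phi : {homo phi : s u / (s <= u)%R} ->
  measurable_fun [set: measurableTypeR R]
    (fun t : measurableTypeR R => (phi t)%:E).
Proof.
by move=> ndphi; apply/measurable_EFinP; exact: nondecreasing_measurable_cumul.
Qed.

(** Since [f] equals its truncation to [[-N, N]], its Stieltjes measure is its own
image under that truncation, against which [phi] becomes a bounded function. *)
Lemma r_measure_integrable f phi : bounded_continuous f ->
  continuous phi -> {homo phi : s u / (s <= u)%R} ->
  (r_measure mu f).-integrable setT (fun t => (phi t)%:E).
Proof.
move=> bf cphi ndphi; have [cf [N' fN']] := bf.
pose N := `|N'|%R; have fN x : (`|f x| <= N)%R by rewrite (le_trans (fN' x))// ler_norm.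
have N0 : (- N <= N)%R by rewrite (@le_trans _ _ 0%R) ?oppr_le0 ?normr_ge0.
have mphi := nondecreasing_measurable_cumul ndphi.
apply/integrableP; split; first exact: EFin_measurable_cumul.
have cc := @continuous_clip (- N) N; have ndc := @clip_nd (- N) N.
rewrite -(clip_bounded_id fN) (eq_integral_r_measure _ bf cc ndc).
rewrite ge0_integral_pushforward//; last 2 first.
- exact: nondecreasing_measurable_cumul.
- apply: measurableT_comp => //; exact: EFin_measurable_cumul.
pose M : R := Num.max `|phi N|%R `|phi (- N)|%R.
rewrite preimage_setT (@le_lt_trans _ _ (\int[r_measure mu f]_t M%:E))//.
  apply: ge0_le_integral => //=.
  - apply/measurable_EFinP.
    apply: (measurableT_comp (@normr_measurable R setT)).
    apply: (@nondecreasing_measurable_cumul (phi \o clip (- N) N)) => s t st.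
    exact/ndphi/ndc.
  - by move=> t _; rewrite lee_fin nondecreasing_norm_le// clip_in.
by rewrite integral_cst// [X in _ * X](r_measureT bf) -dtm_fineT// -EFinM ltry.
Qed.

Lemma R_functional_comp f phi : bounded_continuous f ->
  continuous phi -> {homo phi : s u / (s <= u)%R} ->
  R_functional mu (phi \o f) = \int[r_measure mu f]_t (phi t)%:E.
Proof.
move=> bf cphi ndphi; rewrite /R_functional.
rewrite [LHS](eq_integral_r_measure (fun t : measurableTypeR R => t%:E) bf cphi ndphi).
rewrite integral_pushforward//.
- exact: nondecreasing_measurable_cumul.
- rewrite preimage_setT; exact: r_measure_integrable.
Qed.
End stieltjes_measure_of_a_function.

(** * Properties of R_functional *)

Section R_functional_properties.
Context {R : realType} {X : topologicalType} (mu : set X -> \bar R).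
Hypothesis hmu : finite_dtm mu.
Implicit Types (f : X -> R) (phi psi : R -> R).
Local Notation I := (R_functional mu).

Lemma C_0_bounded_continuous f : C_0 f -> bounded_continuous f.
Proof. by move=> Df; split; [exact: Df.1|have [N _] := C_0_bounded Df; exists N]. Qed.

Lemma R_functional_fin f : bounded_continuous f -> I f \is a fin_num.
Proof.
move=> bf; rewrite -[f]/(id \o f) R_functional_comp//; last by move=> x; exact: cvg_id.
apply: integrable_fin_num => //.
by apply: r_measure_integrable => //; move=> x; exact: cvg_id.
Qed.

Lemma R_functional_linear f phi psi (a b : R) : bounded_continuous f ->
  continuous phi -> {homo phi : s t / (s <= t)%R} ->
  continuous psi -> {homo psi : s t / (s <= t)%R} ->
  (0 <= a)%R -> (0 <= b)%R ->
  I (fun x => a * phi (f x) + b * psi (f x))%R =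
  a%:E * I (phi \o f) + b%:E * I (psi \o f).
Proof.
move=> bf cphi ndphi cpsi ndpsi a0 b0.
pose chi t := (a * phi t + b * psi t)%R.
have cchi : continuous chi.
  by move=> t; apply: cvgD; apply: cvgM;
    [exact: cvg_cst|exact: cphi|exact: cvg_cst|exact: cpsi].
have ndchi : {homo chi : s t / (s <= t)%R}.
  by move=> s t st; rewrite lerD// ler_wpM2l// ?ndphi ?ndpsi.
rewrite -[LHS]/(I (chi \o f)) !R_functional_comp//.
have ip := r_measure_integrable hmu bf cphi ndphi.
have iq := r_measure_integrable hmu bf cpsi ndpsi.
under eq_integral do rewrite EFinD !EFinM.
by rewrite integralD ?integralZl//; exact: integrableZl.
Qed.

Lemma R_functionalZ f (a : R) : bounded_continuous f -> (0 <= a)%R ->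
  I (fun x => a * f x)%R = a%:E * I f.
Proof.
move=> bf a0.
have := R_functional_linear (phi := id) (psi := id) (a := a) (b := 0) bf.
under [X in I X]eq_fun do rewrite mul0r addr0.
rewrite mul0e adde0; apply => //; move=> x; exact: cvg_id.
Qed.

Lemma R_functional0 : I (cst 0%R) = 0.
Proof.
have bz : bounded_continuous (cst 0%R : X -> R).
  exact/C_0_bounded_continuous/C_0_plus_cst0.1.
rewrite (_ : cst 0%R = (fun x : X => 0 * cst 0 x)%R); last first.
  by apply/funext => x; rewrite mul0r.
by rewrite R_functionalZ// mul0e.
Qed.

Lemma R_functionalDcst f (c : R) : bounded_continuous f ->
  I (fun x => f x + c)%R = I f + c%:E * mu setT.
Proof.
move=> bf; have cid : continuous (@id R) by move=> x; exact: cvg_id.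
rewrite -[LHS]/(I ((fun t => t + c)%R \o f)) R_functional_comp//; last 2 first.
- by move=> t; apply: cvgD; [exact: cvg_id|exact: cvg_cst].
- by move=> s t st; rewrite lerD2r.
under eq_integral do rewrite EFinD.
rewrite integralD//; last 2 first.
- exact: (r_measure_integrable hmu bf cid).
- by apply: (r_measure_integrable hmu bf (phi := cst c)) => // x; exact: cvg_cst.
by rewrite integral_cst// [X in _ + _ * X](r_measureT hmu bf).
Qed.

Lemma R_functional_split f (c : R) : bounded_continuous f ->
  I f = I (fun x => Num.min (f x) c) + I (fun x => Num.max (f x - c) 0)%R.
Proof.
move=> bf; pose phi (t : R) := Num.min t c; pose psi (t : R) := Num.max (t - c)%R 0%R.
have cphi : continuous phi by apply: continuous_minc => x; exact: cvg_id.
have cpsi : continuous psi by apply: continuous_excess => x; exact: cvg_id.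
have ndphi : {homo phi : s t / (s <= t)%R} by move=> s t st; rewrite /phi le_min2.
have ndpsi : {homo psi : s t / (s <= t)%R}.
  by move=> s t st; rewrite /psi le_max2// lerB.
transitivity (1%:E * I (phi \o f) + 1%:E * I (psi \o f)); last first.
  by congr (_ + _); exact: mul1e.
apply: etrans (R_functional_linear bf cphi ndphi cpsi ndpsi ler01 ler01).
congr I; apply/funext => x; rewrite !mul1r /phi /psi.
case: (leP (f x) c) => fc; first by rewrite max_r ?addr0 ?subr_le0.
by rewrite max_l ?subrKC// subr_ge0 ltW.
Qed.

Lemma R_functional_clip f (a b : R) : bounded_continuous f ->
  (forall x, a <= f x <= b)%R ->
  I f = \int[r_measure mu f]_t (clip a b t)%:E.
Proof.
move=> bf fab; have cc := @continuous_clip R a b; have ndc := @clip_nd R a b.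
apply: etrans (R_functional_comp hmu bf cc ndc).
by congr I; apply/funext => x /=; rewrite clip_id.
Qed.

Lemma integral_cst_ray f (h t : R) : bounded_continuous f ->
  \int[r_measure mu f]_(s in `]t, +oo[) h%:E = (h * R1 mu f t)%:E.
Proof.
move=> bf; rewrite integral_cst; last exact: measurable_itv.
by rewrite EFinM (R1E hmu t bf.1) [X in _ * X](r_measure_ray hmu t bf).
Qed.

Lemma R_functional_markov f (h : R) : bounded_continuous f ->
  (forall x, 0 <= f x)%R -> (0 <= h)%R -> (h * R1 mu f h)%:E <= I f.
Proof.
move=> bf f0 h0; have [cf [N fN]] := bf.
set M := Num.max N h; have M0 : (0 <= M)%R by rewrite le_max h0 orbT.
rewrite (@R_functional_clip f 0%R M)//; last first.
  by move=> x; rewrite f0 /= le_max (le_trans (ler_norm _)).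
rewrite -integral_cst_ray//.
have c0 t : (0 <= clip 0 M t)%R by case/andP: (clip_in t M0).
have mc : measurable_fun [set: measurableTypeR R]
    (fun t : measurableTypeR R => (clip 0 M t)%:E).
  exact: (EFin_measurable_cumul (@clip_nd _ _ _)).
apply: (@le_trans _ _ (\int[r_measure mu f]_(t in `]h, +oo[) (clip 0 M t)%:E)).
  apply: ge0_le_integral => //.
  - exact: measurable_funTS.
  - move=> t /=; rewrite in_itv/= andbT lee_fin /clip le_min !le_max lexx !orbT andbT.
    by move/ltW => ->.
apply: ge0_subset_integral => // t _; rewrite lee_fin; exact: c0.
Qed.

Lemma R_functional_le_pos f (h : R) : bounded_continuous f ->
  (0 <= h)%R -> (forall x, 0 <= f x <= h)%R -> I f <= (h * R1 mu f 0)%:E.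
Proof.
move=> bf h0 f0h; rewrite (R_functional_clip bf f0h) -integral_cst_ray//.
rewrite [leRHS]integral_mkcond; apply: ge0_le_integral => //.
- by move=> t _; rewrite lee_fin; case/andP: (clip_in t h0).
- exact: (EFin_measurable_cumul (@clip_nd _ _ _)).
- apply/(measurable_restrictT _ _).1; first exact: measurable_itv.
  exact: measurable_cst.
- move=> t _; rewrite patchE; case: ifPn => [_|].
    by rewrite lee_fin; case/andP: (clip_in t h0).
  rewrite notin_setE /= in_itv/= andbT => /negP; rewrite -leNgt => t0.
  by rewrite lee_fin /clip max_r// min_l.
Qed.

(** Markov's inequality sees the set [f > h], while [layered_lower] assumes
[f >= h] on [U]; so it is applied at the levels [h - e], for all small [e]. *)
Lemma R_functional_layered : layered mu I.
Proof.
split=> [f Df|f c Df c0|f U h Df oU h0 hU|f U h cf f0 oU h0 fh fU|f h Df h0 fh].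
- exact/R_functional_fin/C_0_bounded_continuous/Df.1.
- exact/R_functional_split/C_0_bounded_continuous/Df.1.
- have bf := C_0_bounded_continuous Df.1; have cf := Df.1.1.
  rewrite -(fineK (R_functional_fin bf)) -(fineK (dtm_fin_open hmu oU)) -EFinM lee_fin.
  apply: (@le_mesh _ _ _ (fine (mu U))) => e e0.
  have [he|eh] := leP h e.
    rewrite (@le_trans _ _ (e * fine (mu U))%R)//.
      by rewrite ler_wpM2r// fine_ge0// (dtm_ge0 (finite_dtm_dtm hmu))//; left.
    rewrite lerDr -lee_fin fineK ?R_functional_fin//.
    have := R_functional_markov bf Df.2 (lexx 0%R).
    by rewrite mul0r.
  rewrite -lerBlDr -mulrBl -lee_fin fineK ?R_functional_fin//.
  have he0 : (0 <= h - e)%R by rewrite subr_ge0 (ltW eh).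
  apply: le_trans (R_functional_markov bf Df.2 he0).
  rewrite lee_fin ler_wpM2l ?subr_ge0 ?(ltW eh)// -lee_fin R1E// fineK ?dtm_fin_open//.
  apply: dtm_le_open => //; first exact: open_superlevel.
  by move=> x Ux /=; rewrite in_itv/= andbT (lt_le_trans _ (hU _ Ux))// gtrBl.
- have Df := C_c_plus cf f0; have bf := C_0_bounded_continuous Df.1.
  apply: le_trans (R_functional_le_pos bf (ltW h0) _) _.
    by move=> x; rewrite f0 fh.
  rewrite EFinM lee_wpmul2l ?lee_fin ?(ltW h0)// R1E//; last exact: cf.1.
  apply: dtm_le_open => //; first exact/open_superlevel/cf.1.
  move=> x /=; rewrite in_itv/= andbT => fx.
  by apply/fU/nonzero_in_supp; rewrite gt_eqF.
- have bf := C_0_bounded_continuous Df.1.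
  apply: le_trans (R_functional_le_pos bf (ltW h0) _) _.
    by move=> x; rewrite fh Df.2.
  by rewrite -dtm_fineT// -EFinM lee_fin ler_wpM2l ?(ltW h0)// R1_leT//; exact: Df.1.1.
Qed.

End R_functional_properties.

(** * Extending functions of A_plus f to the real line *)

Lemma closure_inf {R : realType} (A : set R) :
  A !=set0 -> has_lbound A -> closure A (inf A).
Proof.
move=> A0 lbA B /nbhs_ballP[e e0 eB].
have [y Ay yA] := inf_adherent e0 (conj A0 lbA).
exists y; split => //; apply: eB; rewrite /ball/= distrC ger0_norm.
  by rewrite ltrBlDl.
by rewrite subr_ge0 ge_inf.
Qed.

Section monotone_extension.
Context {R : realType} {X : topologicalType}.

(** Because [X] is connected, the closure of the range of [f] is the interval
between its infimum and its supremum; truncating to this interval before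
applying [phi] extends [phi] to the real line. *)
Lemma A_plus_extension (f g : X -> R) : connected [set: X] ->
  bounded_continuous f -> A_plus f g ->
  exists phi : R -> R, [/\ continuous phi, {homo phi : s t / (s <= t)%R} &
    g = phi \o f].
Proof.
move=> cX [cf [N fN]] [phi [cphi ndphi _ ->]].
have [X0|/set0P[x0 _]] := eqVneq [set: X] set0.
  exists id; split => //; first by move=> t; exact: cvg_id.
  by apply/funext => x; have : [set: X] x by []; rewrite X0.
set A := closure (range f) in cphi ndphi *.
have fA x : A (f x) by apply: subset_closure; exists x.
have A0 : range f !=set0 by exists (f x0); exists x0.
have ubf : has_ubound (range f).
  by exists N => _ [x _ <-]; rewrite (le_trans (ler_norm _)).
have lbf : has_lbound (range f).
  by exists (- N)%R => _ [x _ <-]; have := fN x; rewrite ler_norml => /andP[].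
set a := inf (range f); set b := sup (range f).
have afb x : (a <= f x <= b)%R.
  apply/andP; split; first by apply: ge_inf => //; exists x.
  by apply: ub_le_sup => //; exists x.
have ab : (a <= b)%R by have /andP[/le_trans] := afb x0; apply.
have itvf : is_interval (range f).
  apply/connected_intervalP; apply: connected_continuous_connected cX _.
  exact: continuous_subspaceT.
have clipA t : A (clip a b t).
  have := clip_in t ab; move: (clip a b t) => u /andP[].
  rewrite le_eqVlt => /orP[/eqP <- _|au]; first exact: closure_inf.
  rewrite le_eqVlt => /orP[/eqP -> |ub]; first exact: closure_sup.
  have [_ [x _ <-] fxu] := inf_lt A0 au.
  have [_ [y _ <-] ufy] := sup_gt A0 ub.
  apply: subset_closure; apply: (itvf (f x) (f y)); [by exists x|by exists y|].
  by rewrite !ltW.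
exists (phi \o clip a b); split.
- move=> t; move/subspace_continuousP : cphi => /(_ _ (clipA t)) cphi.
  apply: cvg_comp cphi => B; rewrite /within/= => AB.
  have near_t : nbhs t (clip a b @^-1` [set y | A y -> B y]).
    exact: (@continuous_clip R a b t _ AB).
  by apply: (filterS _ near_t) => s /=; apply; exact: clipA.
- move=> s t st; apply: ndphi; [exact/mem_set/clipA|exact/mem_set/clipA|].
  exact: clip_nd.
- by apply/funext => x /=; rewrite clip_id.
Qed.

End monotone_extension.

(** * Urysohn functions with compact support *)

(** The one-point compactification is normal, which yields [h] with values in
[[0, 1]], equal to [1] on [C] and to [0] off [U], in particular at infinity.
Truncating at height 1/2 makes the support compact, and stretching the rest
gives the value [1] on a whole neighbourhood of [C]. *)
Lemma urysohn_compact_support (R : realType) (X : topologicalType) (C U : set X) :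
  hausdorff_space X -> locally_compact [set: X] ->
  compact C -> open U -> C `<=` U ->
  exists f : X -> R, [/\ C_c f, forall x, (0 <= f x <= 1)%R, supp f `<=` U &
    exists2 V, open V & C `<=` V /\ forall x, V x -> f x = 1%R].
Proof.
move=> hX lcX cC oU CU; pose Y := one_point_compactification X.
have hY : hausdorff_space Y by exact: one_point_compactification_hausdorff.
have cY : compact [set: Y] by exact: one_point_compactification_compact.
have /normal_separatorP nY := compact_normal hY cY.
have cS : continuous (Some : X -> Y) by exact: one_point_compactification_some_continuous.
have clC : closed (Some @` C : set Y).
  apply: compact_closed => //; apply: continuous_compact => //.
  exact: continuous_subspaceT.
have clU : closed (~` (Some @` U) : set Y).
  by apply: open_closedC; exact: one_point_compactification_open_some.
have disj : ~` (Some @` U : set Y) `&` (Some @` C) = set0.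
  by apply/disjoints_subset; apply: subsetC; exact: image_subset.
have [h [ch h01 h0 h1]] := (uniform_separatorP (R := R) _ _).1 (nY R _ _ clU clC disj).
have hs x : (0 <= h (Some x) <= 1)%R.
  by have /h01 := imageT h (Some x : Y); rewrite /= in_itv.
pose f x := Num.min (Num.max (4 * h (Some x) - 2)%R 0%R) 1%R.
pose W := [set x : X | (2^-1 <= h (Some x))%R].
have chS : continuous (h \o Some).
  by move=> x; apply: continuous_comp; [exact: cS|exact: ch].
have clW : closed W by exact: (closed_superlevel (f := h \o Some)).
have hout y : ~ (Some @` U) y -> h y = 0%R by move=> nU; apply: h0; exists y.
have WU : W `<=` U.
  move=> x; rewrite /W/= => hx; apply: contrapT => nUx; move: hx.
  rewrite hout ?leNgt ?invr_gt0 ?ltr0n// => -[y Uy [yx]].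
  by apply: nUx; rewrite -yx.
have suppW : supp f `<=` W.
  apply: supp_subset => // x; apply: contra_neqP => /negP; rewrite -ltNge => hx.
  by rewrite /f max_r ?min_l//; lra.
(* The preimage of a neighbourhood of infinity contains the complement of a
   compact set. *)
have cptW : compact W.
  have : nbhs (None : Y) [set y | (h y < 2^-1)%R].
    have hN : h None = 0%R by apply: hout => -[].
    have := ch None; rewrite /continuous_at hN => /(_ [set t | t < 2^-1]%R); apply.
    by apply: open_nbhs_nbhs; split; [exact: open_lt|rewrite /= invr_gt0].
  move=> [K [cK clK] KW]; apply: subclosed_compact clW cK _ => x Wx.
  apply: contrapT => nKx; have /= := KW (Some x) (or_introl (ex_intro2 _ _ x nKx erefl)).
  by rewrite ltNge => /negP; apply.
exists f; split.
- split; last by apply: subclosed_compact suppW => //; exact: closed_closure.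
  apply: continuous_minc.
  apply: (@continuous_excess R X (fun x => 4 * h (Some x))%R) => x.
  by apply: cvgM; [exact: cvg_cst|exact: chS].
- by move=> x; rewrite /f le_min le_max lexx orbT ler01/= ge_min lexx orbT.
- exact: subset_trans WU.
- exists ((h \o Some) @^-1` `](3 / 4)%R, +oo[); first exact: open_superlevel.
  split=> x.
    move=> Cx; have hx : h (Some x) = 1%R by apply: h1; exists (Some x) => //; exists x.
    by rewrite /= in_itv/= andbT hx; lra.
  by rewrite /= in_itv/= andbT => hx; rewrite /f max_l ?min_r//; lra.
Qed.

(** * Layered functionals represent mu *)

Section layered_functionals_represent.
Context {R : realType} {X : topologicalType} (mu : set X -> \bar R).
Hypothesis hmu : finite_dtm mu.
Implicit Types (f g : X -> R) (rho : (X -> R) -> \bar R).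

Lemma supnorm_le1 f : supnorm f <= 1 <-> forall x, (`|f x| <= 1)%R.
Proof.
split=> [f1 x|f1].
  by rewrite -lee_fin; apply: le_trans f1; apply: ereal_sup_ubound; exists x.
by apply: ge_ereal_sup => _ [x _ <-]; rewrite lee_fin.
Qed.

Lemma le_functional_norm D rho f : D f -> (forall x, `|f x| <= 1)%R ->
  `|rho f| <= functional_norm D rho.
Proof.
by move=> Df f1; apply: ereal_sup_ubound; exists f => //; split => //; exact/supnorm_le1.
Qed.

(** By homogeneity it suffices to bound [rho] on functions of height [1], which
is what the definition of [mu_open] does. *)
Lemma layered_intro rho :
  (forall f, C_0_plus f -> rho f \is a fin_num) ->
  (forall f (c : R), C_0_plus f -> (0 < c)%R ->
    rho f = rho (fun x => Num.min (f x) c)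
            + rho (fun x => Num.max (f x - c) 0)%R) ->
  (forall f g, C_0_plus f -> C_0_plus g -> (forall x, g x <= f x)%R ->
    rho g <= rho f) ->
  (forall f (a : R), C_0_plus f -> (0 < a)%R ->
    rho (fun x => a * f x)%R = a%:E * rho f) ->
  (forall f, C_0_plus f -> (forall x, f x <= 1)%R -> rho f <= mu setT) ->
  (forall U, open U -> mu U = mu_open rho U) ->
  layered mu rho.
Proof.
move=> rfin rsplit rle rZ rT rmu.
have scale f (h : R) : C_0_plus f -> (0 < h)%R ->
    C_0_plus (fun x => h^-1 * f x)%R /\
    rho f = h%:E * rho (fun x => h^-1 * f x)%R.
  move=> Df h0; have Dh : C_0_plus (fun x => h^-1 * f x)%R.
    by apply: C_0_plusZ => //; rewrite invr_ge0 ltW.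
  split => //; rewrite -rZ//; congr rho; apply/funext => x.
  by rewrite mulVKf// gt_eqF.
split=> // [f U h Df oU h0 hU|f U h cf f0 oU h0 fh fU|f h Df h0 fh].
- have [Dh ->] := scale f h Df h0; rewrite lee_wpmul2l ?lee_fin ?(ltW h0)//.
  rewrite rmu//; apply: ge_ereal_sup => _ [u [cu u01 suU] <-].
  apply: rle => // [|x]; first by apply: C_c_plus => // x; case/andP: (u01 x).
  have [->|/nonzero_in_supp/suU/hU hf] := eqVneq (u x) 0%R; first exact: Dh.2.
  case/andP: (u01 x) => _ /le_trans; apply.
  by rewrite mulrC ler_pdivlMr// mul1r.
- have Df := C_c_plus cf f0; have [Dh ->] := scale f h Df h0.
  rewrite lee_wpmul2l ?lee_fin ?(ltW h0)// rmu//.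
  apply: ereal_sup_ubound; eexists; last reflexivity.
  have sh : supp (fun x => h^-1 * f x)%R `<=` supp f.
    apply: supp_subset => [|x]; first exact: closed_closure.
    by rewrite mulf_eq0 negb_or => /andP[_]; exact: nonzero_in_supp.
  split; [split; first exact: Dh.1.1| |exact: subset_trans fU].
    by apply: subclosed_compact cf.2 sh; exact: closed_closure.
  by move=> x; rewrite Dh.2/= mulrC ler_pdivrMr// mul1r.
- have [Dh ->] := scale f h Df h0.
  rewrite lee_wpmul2l ?lee_fin ?(ltW h0)// rT// => x.
  by rewrite mulrC ler_pdivrMr// mul1r.
Qed.

Hypotheses (hX : hausdorff_space X) (lcX : locally_compact [set: X]).

Lemma layered_mu_open rho U : layered mu rho -> open U -> mu U = mu_open rho U.
Proof.
move=> Lr oU; apply/eqP; rewrite eq_le; apply/andP; split.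
  rewrite (dtm_inner (finite_dtm_dtm hmu) oU).
  apply: ge_ereal_sup => _ [C [cC CU] <-].
  have [f [cf f01 fU [V oV [CV fV]]]] := urysohn_compact_support R hX lcX cC oU CU.
  have Df : C_0_plus f by apply: C_c_plus => // x; case/andP: (f01 x).
  apply: (le_trans (dtm_le_compact hmu cC oV CV)).
  apply: (@le_trans _ _ (rho f)); last by apply: ereal_sup_ubound; exists f.
  rewrite -[mu V]mul1e; apply: (layered_lower Lr) => // x Vx.
  by rewrite fV.
apply: ge_ereal_sup => _ [f [cf f01 fU] <-]; rewrite -[mu U]mul1e.
by apply: (layered_upper Lr) => // x; case/andP: (f01 x).
Qed.

Lemma layered_eq_mu rho : layered mu rho -> eq_mu_of mu rho.
Proof.
move=> Lr; split=> [U|F cF]; first exact: layered_mu_open.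
rewrite (dtm_outer (finite_dtm_dtm hmu) cF) /mu_closed; congr ereal_inf.
by apply: eq_imagel => U [oU _]; exact: layered_mu_open.
Qed.

Lemma layered_norm rho : layered mu rho ->
  functional_norm C_0_plus rho = mu setT.
Proof.
move=> Lr; apply/eqP; rewrite eq_le; apply/andP; split.
  apply: ge_ereal_sup => _ [f [Df /supnorm_le1 f1] <-].
  rewrite gee0_abs; last exact: layered_ge0 hmu _ Lr _ Df.
  rewrite -[mu setT]mul1e; apply: (layered_upperT Lr) => // x.
  by rewrite (le_trans (ler_norm _)).
rewrite (layered_mu_open Lr openT); apply: ge_ereal_sup => _ [f [cf f01 _] <-].
rewrite (le_trans (lee_abs _))//; apply: le_functional_norm.
  by apply: C_c_plus => // x; case/andP: (f01 x).
by move=> x; case/andP: (f01 x) => f0 f1; rewrite ger0_norm.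
Qed.

End layered_functionals_represent.

(** * The functionals of the theorem are layered *)

Section functionals_of_the_theorem_are_layered.
Context {R : realType} {X : topologicalType} (mu : set X -> \bar R).
Hypothesis hmu : finite_dtm mu.
Implicit Types (f g : X -> R) (rho : (X -> R) -> \bar R).

Lemma A_plus_id f : A_plus f f.
Proof.
exists id; split => //; apply: continuous_subspaceT => t; exact: cvg_id.
Qed.

Lemma p_conic_layered rho : p_conic_quasi_linear C_0_plus rho ->
  functional_norm C_0_plus rho = mu setT -> eq_mu_of mu rho -> layered mu rho.
Proof.
move=> pc nT [muo _].
have rZ f (a : R) : C_0_plus f -> (0 < a)%R ->
    rho (fun x => a * f x)%R = a%:E * rho f.
  move=> Df a0.
  have := p_conic_linear pc Df.1 (A_plus_id f) Df (A_plus_id f) Df (ltW a0) (lexx 0%R).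
  rewrite mul0e adde0 => <-; congr rho; apply/funext => x.
  by rewrite mul0r addr0.
have r1 f : C_0_plus f -> (forall x, f x <= 1)%R -> `|rho f| <= mu setT.
  move=> Df f1; rewrite -nT; apply: le_functional_norm => // x.
  by rewrite ger0_norm//; exact: Df.2.
apply: layered_intro => //.
- move=> f Df; have [N N0 fN] := C_0_bounded Df.1.
  have a0 : (0 < N + 1)%R by rewrite ltr_wpDl.
  have Dh : C_0_plus (fun x => (N + 1)^-1 * f x)%R.
    by apply: C_0_plusZ => //; rewrite invr_ge0 ltW.
  have -> : f = (fun x => (N + 1) * ((N + 1)^-1 * f x))%R.
    by apply/funext => x; rewrite mulVKf// gt_eqF.
  rewrite rZ//; apply: fin_numM => //; rewrite fin_num_abs.
  rewrite (le_lt_trans _ (finite_dtm_lty hmu))// r1// => x.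
  rewrite mulrC ler_pdivrMr// mul1r (le_trans (ler_norm _))// (le_trans (fN x))//.
  by rewrite lerDl.
- move=> f c Df c0; have Dm := C_0_plus_minc (ltW c0) Df.
  have De := C_0_plus_excess (ltW c0) Df.
  have Am : A_plus f (fun x => Num.min (f x) c).
    exists (fun t => Num.min t c); split => //.
    + by apply: continuous_subspaceT; apply: continuous_minc => t; exact: cvg_id.
    + by move=> s t _ _ st; rewrite le_min2.
    + by move=> _; rewrite min_l// ltW.
  have Ae : A_plus f (fun x => Num.max (f x - c) 0)%R.
    exists (fun t => Num.max (t - c) 0)%R; split => //.
    + by apply: continuous_subspaceT; apply: continuous_excess => t; exact: cvg_id.
    + by move=> s t _ _ st; rewrite le_max2// lerB.
    + by move=> _; rewrite max_r// sub0r oppr_le0 ltW.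
  have := p_conic_linear pc Df.1 Am Dm Ae De ler01 ler01.
  rewrite !mul1e => <-; congr rho; apply/funext => x; rewrite !mul1r.
  case: (leP (f x) c) => fc; first by rewrite max_r ?addr0 ?subr_le0.
  by rewrite max_l ?subrKC// subr_ge0 ltW.
- by move=> f g Df Dg gf; apply: (p_conic_monotone pc) => //; exact: Dg.2.
- by move=> f Df f1; rewrite (le_trans (lee_abs _))// r1.
Qed.

Lemma r_functional_layered rho : r_functional rho -> real_valued C_all rho ->
  functional_norm C_all rho = mu setT -> eq_mu_of mu rho -> layered mu rho.
Proof.
move=> rr rv nT [muo _]; apply: layered_intro => //.
- by move=> f Df; exact/rv/Df.1.1.
- move=> f c Df c0; have cf := Df.1.1.
  have cm := continuous_minc (c := c) cf; have ce := continuous_excess (c := c) cf.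
  have cmc : continuous (fun x => Num.min (f x) c - c)%R.
    by move=> x; apply: cvgB; [exact: cm|exact: cvg_cst].
  have c_fin : rho (cst (- c)%R) \is a fin_num.
    by apply: rv => x; exact: cvg_cst.
  rewrite -[LHS](addeK _ c_fin) -[RHS](addeK _ c_fin); congr (_ - _).
  rewrite -(r_fun_constant rr (- c)%R cf) [in RHS](addeC (rho _)) -addeA.
  rewrite -(r_fun_constant rr (- c)%R cm) -(r_fun_orthogonal rr ce cmc).
  - congr rho; apply/funext => x /=; case: (leP (f x) c) => fc.
      by rewrite max_r ?add0r ?subr_le0.
    by rewrite max_l ?subrr ?addr0// subr_ge0 ltW.
  - move=> x; case: (leP (f x) c) => fc.
      by rewrite max_r ?mul0r// subr_le0.
    by rewrite subrr mulr0.
  - by right; split=> x; [rewrite le_max lexx orbT|rewrite subr_le0 ge_min lexx orbT].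
- by move=> f g Df Dg gf; apply: (r_fun_monotone rr);
    [exact: Df.1.1|exact: Dg.1.1|exact: Dg.2|].
- by move=> f a Df a0; apply: (r_fun_homogeneous rr) => //; exact: Df.1.1.
- move=> f Df f1; rewrite (le_trans (lee_abs _))// -nT.
  apply: le_functional_norm; first exact: Df.1.1.
  by move=> x; rewrite ger0_norm//; exact: Df.2.
Qed.

End functionals_of_the_theorem_are_layered.

(** * R_functional is p-conic quasi-linear and an r-functional *)

Section existence.
Context {R : realType} {X : topologicalType} (mu : set X -> \bar R).
Hypothesis hmu : finite_dtm mu.
Local Notation I := (R_functional mu).

Lemma functional_on_real (D : set (X -> R)) rho :
  D (cst 0%R) -> real_valued D rho -> functional_on D rho.
Proof.
move=> D0 rv; have fin f : D f -> rho f != +oo /\ rho f != -oo.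
  by move=> /rv; rewrite fin_numE => /andP[].
split; [by left => f /fin[]|by exists (cst 0%R); have [] := fin _ D0
  |by exists (cst 0%R); have [] := fin _ D0].
Qed.

Lemma R_functional_p_conic : connected [set: X] ->
  p_conic_quasi_linear C_0_plus I.
Proof.
move=> cX; have Lr := R_functional_layered hmu; split.
- exact: functional_on_real C_0_plus_cst0 (layered_fin Lr).
- exact: (layered_fin Lr C_0_plus_cst0).
- by move=> f g Df Dg fg0 _ _; exact: (layered_orthogonal hmu Lr).
- by move=> f g Df Dg _ gf; exact: (layered_le hmu Lr).
- move=> f Df g h Ag Dg Ah Dh a b a0 b0; have bf := C_0_bounded_continuous Df.
  have [phi [cphi ndphi ->]] := A_plus_extension cX bf Ag.
  have [psi [cpsi ndpsi ->]] := A_plus_extension cX bf Ah.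
  exact: R_functional_linear.
Qed.

Section compact_space.
Hypothesis cptX : compact [set: X].

Lemma compact_C_0 (f : X -> R) : continuous f -> C_0 f.
Proof. by move=> cf; split => // e e0; exists setT => // x; case. Qed.

Lemma compact_C_0_plus (f : X -> R) : continuous f -> (forall x, 0 <= f x)%R ->
  C_0_plus f.
Proof. by move=> cf f0; split => //; exact: compact_C_0. Qed.

Lemma compact_bounded_continuous (f : X -> R) :
  continuous f -> bounded_continuous f.
Proof. by move=> /compact_C_0; exact: C_0_bounded_continuous. Qed.

Lemma R_functional_real_valued : real_valued C_all I.
Proof.
by move=> f cf; apply: R_functional_fin => //; exact: compact_bounded_continuous.
Qed.

Lemma R_functional_cst (c : R) : I (cst c) = c%:E * mu setT.
Proof.
have c0 : continuous (cst 0%R : X -> R) by move=> x; exact: cvg_cst.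
rewrite -[RHS]add0e -(R_functional0 hmu).
rewrite -(R_functionalDcst hmu _ (compact_bounded_continuous c0)).
by congr I; apply/funext => x; rewrite /= add0r.
Qed.

Lemma R_functional_r_functional : r_functional I.
Proof.
have Lr := R_functional_layered hmu; have D0 : C_all (cst 0%R : X -> R).
  by move=> x; exact: cvg_cst.
split.
- exact: functional_on_real D0 R_functional_real_valued.
- exact: R_functional_real_valued.
- move=> f a cf a0; apply: R_functionalZ => //; last exact: ltW.
  exact: compact_bounded_continuous.
- move=> f g cf cg g0 gf; apply: (layered_le hmu Lr) => //.
  + by apply: compact_C_0_plus => // x; exact: le_trans (gf x).
  + exact: compact_C_0_plus.
- move=> f g cf cg fg0 [[f0 g0]|[f0 g0]].
    by apply: (layered_orthogonal hmu Lr) => //; exact: compact_C_0_plus.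
  have cfg : continuous (f \+ g)%R by move=> x; apply: cvgD; [exact: cf|exact: cg].
  have fgE x : f x = 0%R \/ g x = 0%R.
    by have /eqP := fg0 x; rewrite mulf_eq0 => /orP[] /eqP ->; [left|right].
  have fE : (fun x => Num.max ((f \+ g) x - 0) 0)%R = f.
    apply/funext => x /=; rewrite subr0.
    by case: (fgE x) => ->; rewrite ?add0r ?addr0; [exact: max_r|exact: max_l].
  have gE : (fun x => Num.min ((f \+ g) x) 0)%R = g.
    apply/funext => x /=.
    by case: (fgE x) => ->; rewrite ?add0r ?addr0; [exact: min_l|exact: min_r].
  apply: etrans (R_functional_split hmu 0%R (compact_bounded_continuous cfg)) _.
  apply: etrans (addeC _ _) _.
  exact: (f_equal2 (fun u v => I u + I v) fE gE).
- move=> f c cf; rewrite R_functional_cst; apply: R_functionalDcst => //.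
  exact: compact_bounded_continuous.
Qed.

Hypotheses (hX : hausdorff_space X) (lcX : locally_compact [set: X]).

(** If [|f| <= 1] then [0 <= f + 1 <= 2], so the value at [f + 1], which is
[R_functional mu f + mu X], lies between [0] and [2 mu X]. *)
Lemma R_functional_norm_all : functional_norm C_all I = mu setT.
Proof.
have Lr := R_functional_layered hmu.
apply/eqP; rewrite eq_le; apply/andP; split; last first.
  rewrite -(layered_norm hmu hX lcX Lr).
  apply: ge_ereal_sup => _ [f [Df f1] <-]; apply: ereal_sup_ubound.
  by exists f => //; split => //; exact: Df.1.1.
apply: ge_ereal_sup => _ [f [cf /supnorm_le1 f1] <-].
have bf := compact_bounded_continuous cf.
have D1 : C_0_plus (fun x => f x + 1)%R.
  apply: compact_C_0_plus => x; last by have := f1 x; rewrite ler_norml; lra.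
  by apply: cvgD; [exact: cf|exact: cvg_cst].
have := layered_ge0 hmu Lr D1.
have := @layered_upperT _ _ _ _ Lr _ 2%R D1 (ltr0n _ 2).
have f2 x : (f x + 1 <= 2)%R by have := f1 x; rewrite ler_norml; lra.
move=> /(_ f2); rewrite (R_functionalDcst hmu _ bf) mul1e -dtm_fineT//.
rewrite -(fineK (R_functional_fin hmu bf)) -EFinM -EFinD !lee_fin.
by move=> u l; rewrite ler_norml; lra.
Qed.

Lemma r_functional_unique rho : r_functional rho -> real_valued C_all rho ->
  functional_norm C_all rho = mu setT -> eq_mu_of mu rho ->
  forall f : X -> R, continuous f -> rho f = I f.
Proof.
move=> rr rv nT re f cf; have Lr := r_functional_layered rr rv nT re.
have Li := R_functional_layered hmu.
have [N N0 fN] := C_0_bounded (compact_C_0 cf).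
have cN : continuous (cst N : X -> R) by move=> x; exact: cvg_cst.
have DN : C_0_plus (cst N : X -> R) by exact: compact_C_0_plus.
have DfN : C_0_plus (fun x => f x + N)%R.
  apply: compact_C_0_plus => x; last by have := fN x; rewrite ler_norml; lra.
  by apply: cvgD; [exact: cf|exact: cvg_cst].
have := layered_unique hmu Li Lr DfN.
rewrite (r_fun_constant rr N cf) (r_fun_constant R_functional_r_functional N cf).
rewrite (layered_unique hmu Li Lr DN) => H.
have fin := R_functional_real_valued cN.
by rewrite -[LHS](addeK _ fin) H addeK.
Qed.

End compact_space.
End existence.

(** * The representation theorem *)

Theorem theorem8p1 (R : realType) (X : topologicalType)
    (hX : hausdorff_space X) (lcX : locally_compact [set: X])
    (cX : connected [set: X])
    (mu : set X -> \bar R) (hmu : finite_dtm mu) :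
  (exists rho : (X -> R) -> \bar R,
    [/\ [/\ p_conic_quasi_linear C_0_plus rho,
            functional_norm C_0_plus rho < +oo,
            eq_mu_of mu rho
          & functional_norm C_0_plus rho = mu setT],
        (forall rho' : (X -> R) -> \bar R,
          [/\ p_conic_quasi_linear C_0_plus rho',
              functional_norm C_0_plus rho' < +oo,
              eq_mu_of mu rho'
            & functional_norm C_0_plus rho' = mu setT] ->
          forall f, C_0_plus f -> rho' f = rho f)
      & forall f, C_0_plus f -> rho f = R_functional mu f])
  /\
  (compact [set: X] ->
   exists rho : (X -> R) -> \bar R,
    [/\ [/\ r_functional rho,
            real_valued C_all rho,
            eq_mu_of mu rho
          & functional_norm C_all rho = mu setT],
        (forall rho' : (X -> R) -> \bar R,
          [/\ r_functional rho',
              real_valued C_all rho',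
              eq_mu_of mu rho'
            & functional_norm C_all rho' = mu setT] ->
          forall f, C_all f -> rho' f = rho f)
      & forall f, C_all f -> rho f = R_functional mu f]).
Proof.
have Li := R_functional_layered hmu.
have muI := layered_eq_mu hmu hX lcX Li.
split.
  exists (R_functional mu); have nI := layered_norm hmu hX lcX Li.
  split; last by move=> f Df; reflexivity.
    split; [exact: R_functional_p_conic| |exact: muI|exact: nI].
    by rewrite nI; exact: finite_dtm_lty hmu.
  move=> rho' [pc _ re nT] f Df.
  exact: layered_unique hmu Li (p_conic_layered hmu pc nT re) f Df.
move=> cptX; exists (R_functional mu).
split; last by move=> f cf; reflexivity.
  split; [exact: R_functional_r_functional|exact: R_functional_real_valued
    |exact: muI|exact: R_functional_norm_all].
move=> rho' [rr rv re nT] f cf.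
exact: (r_functional_unique hmu cptX rr rv nT re).
Qed.
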